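(* Let $G\ge 2$ and let $r_{t,1},\dots,r_{t,G}$ be i.i.d. random variables with values in $[0,1]$, having an absolutely continuous distribution with CDF $F$, density $f$, and mean $p_t$. Let $\hat p_t=\frac1G\sum_{i}r_{t,i}$, $\hat A_{t,i}=r_{t,i}-\hat p_t$, $A_{t,i}=r_{t,i}-p_t$. Fix $\sigma\in[0,1]$ and let $S_\sigma:=\{\exists\, i\ne j:\ |r_{t,i}-r_{t,j}|>\sigma\}$, so $S_\sigma^c=\{\max_i r_{t,i}-\min_i r_{t,i}\le\sigma\}$. For $u\in[0,1]$ let $u^+:=\min\{1,u+\sigma\}$, $q(u):=F(u^+)-F(u)$, and, when $q(u)>0$, $m(u):=\mathbb E[r_{t,1}\mid u\le r_{t,1}\le u^+]=\frac{\int_u^{u^+}xf(x)\,dx}{F(u^+)-F(u)}$. Then \[ \mathbb P(S_\sigma^c)=G\int_0^1 f(u)\,q(u)^{G-1}\,du,\qquad \mathbb P(S_\sigma)=1-\mathbb P(S_\sigma^c), \] \[ \mathbb E[\hat p_t\,\mathbf 1_{S_\sigma^c}]=\int_0^1\bigl(u+(G-1)m(u)\bigr)f(u)\,q(u)^{G-1}\,du, \] and, if $\mathbb P(S_\sigma)>0$, \[ \mathbb E[\hat p_t\mid S_\sigma]=\frac{p_t-\mathbb E[\hat p_t\,\mathbf 1_{S_\sigma^c}]}{\mathbb P(S_\sigma)},\qquad \mathbb E[\hat A_{t,i}-A_{t,i}\mid S_\sigma]=p_t-\mathbb E[\hat p_t\mid S_\sigma]\ \text{ for all } i. \]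
   Context: Non-binary reward extension of the group-relative setting: $G$ rewards in $[0,1]$ for one prompt, group baseline $\hat p_t$, group-relative advantage $\hat A_{t,i}$, expected advantage $A_{t,i}$; $S_\sigma$ is the ''update'' event that some two rewards in the group differ by more than $\sigma$. In the integrand, $m(u)$ is only needed where $q(u)>0$ (the integrand vanishes otherwise). *)

(* Defs.v *)
From HB Require Import structures.
From mathcomp Require Import all_boot all_order all_algebra.
From mathcomp Require Import all_classical all_reals all_analysis.
Set Implicit Arguments. Unset Strict Implicit. Unset Printing Implicit Defensive.
Import Order.TTheory GRing.Theory Num.Theory.
Import numFieldNormedType.Exports.
Local Open Scope classical_set_scope.
Local Open Scope ring_scope.

Section defs.
Context {d : measure_display} {T : measurableType d} {R : realType}.

Definition mutually_independent (G : nat) (P : probability T R)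
  (r : 'I_G -> T -> R) : Prop :=
  forall (J : {set 'I_G}) (A : 'I_G -> set R),
    (forall j, measurable (A j)) ->
    P (\bigcap_(j in [set j | j \in J]) (r j @^-1` A j)) =
    (\prod_(j in J) P (r j @^-1` A j))%E.

Definition phat (G : nat) (r : 'I_G -> T -> R) (w : T) : R :=
  (G%:R)^-1 * \sum_(i < G) r i w.

Definition Ahat (G : nat) (r : 'I_G -> T -> R) (i : 'I_G) (w : T) : R :=
  r i w - phat r w.
Definition Aexp (G : nat) (r : 'I_G -> T -> R) (p : R) (i : 'I_G) (w : T) : R :=
  r i w - p.

Definition Supd (G : nat) (r : 'I_G -> T -> R) (sigma : R) : set T :=
  [set w | exists i j : 'I_G, i != j /\ sigma < `|r i w - r j w|].

Definition condE (P : probability T R) (S : set T) (X : T -> R) : R :=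
  fine (\int[P]_(w in S) (X w)%:E) / fine (P S).
End defs.

Section defs2.
Context {R : realType}.
Definition uplus (sigma u : R) : R := Num.min 1 (u + sigma).
Definition qfun (F : R -> R) (sigma u : R) : R := F (uplus sigma u) - F u.
(* m(u) = (int_u^{u+} x f(x) dx) / q(u); only meaningful when q(u) > 0 *)
Definition mcond (F f : R -> R) (sigma u : R) : R :=
  fine (\int[@lebesgue_measure R]_(x in `[u, uplus sigma u]) (x * f x)%:E)
  / qfun F sigma u.
End defs2.

(* Main.v *)
Require Import Defs.
From HB Require Import structures.
From mathcomp Require Import all_boot all_order all_algebra.
From mathcomp Require Import all_classical all_reals all_analysis.
From mathcomp Require Import measurable_realfun ring lra.
Import Order.TTheory GRing.Theory Num.Theory.
Import numFieldNormedType.Exports.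
Local Open Scope classical_set_scope.
Local Open Scope ring_scope.

(** The complement of [Supd] is the union over [k] of the events "[r k] is the
    least reward and every other reward lies in [[r k, uplus (r k)]]".  Since
    the common law has a density, two rewards coincide with probability zero,
    so this union is almost surely disjoint and the expectations over the
    complement are sums over [k].  By independence one may condition on
    [r k = u]: the other rewards fall in the window with probability
    [q u ^+ G.-1], and with one of them weighted by its value the factor is
    [q u ^+ (G - 2)] times the integral of [x * f x] over the window.
    Integrating over [u] against [f] gives both formulas; the conditional
    expectations follow by splitting the integral of [phat] along [Supd]. *)

(** * Measures given by a density *)

Section density.
Context d (T : measurableType d) (R : realType).
Variables (mu : {measure set T -> \bar R}) (f : T -> R).
Hypotheses (f0 : forall x, 0 <= f x) (mf : measurable_fun setT f).
Local Open Scope ereal_scope.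

(** The proofs about [f] are arguments of the definition, so that a measure structure can be
    attached to the term itself. *)
Definition density of (forall x, (0 <= f x)%R) & measurable_fun setT f :=
  fun A : set T => \int[mu]_(x in A) (f x)%:E.

Let nu := density f0 mf.

Let density0 : nu set0 = 0.
Proof. by rewrite /nu /density integral_set0. Qed.

Let density_ge0 A : 0 <= nu A.
Proof. by apply: integral_ge0 => x _; rewrite lee_fin. Qed.

Let density_sigma_additive : semi_sigma_additive nu.
Proof.
move=> A mA tA mUA; rewrite /nu /density; apply: cvg_toP.
  apply: ereal_nondecreasing_is_cvgn => m n mn.
  by apply: lee_sum_nneg_natr => // k _ _; exact: density_ge0.
rewrite ge0_integral_bigcup//=.
- exact/measurable_EFinP/measurable_funTS.
- by move=> x _; rewrite lee_fin.
Qed.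

HB.instance Definition _ := isMeasure.Build _ _ _ nu
  density0 density_ge0 density_sigma_additive.

End density.

(** * Integration against a measure with a density *)

Section integral_density.
Context d (T : measurableType d) (R : realType).
Variables (mu nu : {measure set T -> \bar R}) (f : T -> R).
Hypotheses (f0 : forall x, 0 <= f x) (mf : measurable_fun setT f).
Local Open Scope ereal_scope.
Hypothesis nuE : forall A, measurable A -> nu A = \int[mu]_(x in A) (f x)%:E.

Import HBNNSimple.

(** A simple function is a finite sum of multiples of indicators, so linearity reduces the claim to
    [nuE]. *)
Let integral_density_nnsfun D (g : {nnsfun T >-> R}) : measurable D ->
  \int[nu]_(x in D) (g x)%:E = \int[mu]_(x in D) ((g x)%:E * (f x)%:E).
Proof.
move=> mD; under [LHS]eq_integral do rewrite fimfunE -fsumEFin//.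
rewrite [LHS]ge0_integral_fsum//; last 2 first.
  - by move=> y; exact/measurable_EFinP/measurableT_comp.
  - by move=> y x _; rewrite EFinM nnfun_muleindic_ge0.
under [RHS]eq_integral.
  move=> x _; rewrite fimfunE -fsumEFin// ge0_mule_fsuml; last first.
    by move=> y; rewrite EFinM nnfun_muleindic_ge0.
  over.
rewrite [RHS]ge0_integral_fsum//; last 2 first.
  - move=> y; apply: emeasurable_funM; last exact/measurable_EFinP/measurable_funTS.
    exact/measurable_EFinP/measurableT_comp.
  - move=> y x _; rewrite mule_ge0//; last by rewrite lee_fin.
    by rewrite EFinM nnfun_muleindic_ge0.
apply: eq_fsbigr => y /[!inE] -[x _ <-].
rewrite integralZl_indic_nnsfun//= integral_indic// nuE; last exact: measurableI.
under [RHS]eq_integral do rewrite EFinM -muleA.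
rewrite [RHS]ge0_integralZl_EFin//; last 2 first.
  - by move=> t _; rewrite mule_ge0 ?lee_fin.
  - apply: emeasurable_funM; last exact/measurable_EFinP/measurable_funTS.
    exact/measurable_EFinP/measurable_indic.
congr (_ * _).
rewrite setIC integral_mkcondr epatch_indic; apply: eq_integral => t _.
by rewrite muleC.
Qed.

(** Monotone convergence passes from the simple functions [g_ n] to their increasing limit [g], on
    both sides. *)
Lemma ge0_integral_density D (g : T -> \bar R) : measurable D ->
  measurable_fun D g -> (forall x, D x -> 0 <= g x) ->
  \int[nu]_(x in D) g x = \int[mu]_(x in D) (g x * (f x)%:E).
Proof.
move=> mD mg g0; pose g_ := nnsfun_approx mD mg.
transitivity (limn (fun n => \int[nu]_(x in D) (g_ n x)%:E)).
  rewrite -monotone_convergence//=.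
  - apply: eq_integral => x /[!inE] xD; apply/esym/cvg_lim => //=.
    exact: cvg_nnsfun_approx.
  - by move=> n; exact/measurable_EFinP/measurable_funTS.
  - by move=> n x _; rewrite lee_fin.
  - by move=> x _ m n mn; rewrite lee_fin; exact/lefP/nd_nnsfun_approx.
under eq_fun do rewrite integral_density_nnsfun//.
rewrite -monotone_convergence//=.
- apply: eq_integral => x /[!inE] xD; apply/cvg_lim => //=.
  apply: cvgeZr => //; exact: cvg_nnsfun_approx.
- move=> n; apply: emeasurable_funM; exact/measurable_EFinP/measurable_funTS.
- by move=> n x _; rewrite mule_ge0 ?lee_fin.
- move=> x _ m n mn; rewrite lee_pmul ?lee_fin//.
  exact/lefP/nd_nnsfun_approx.
Qed.

End integral_density.

(** * Uniqueness of a measure with a given distribution function *)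

Section measure_cdf.
Context (R : realType).
Variables m1 m2 : {measure set (measurableTypeR R) -> \bar R}.
Local Open Scope ereal_scope.

(** Finite values on half-lines can be subtracted, so the measures agree on all []a, b]]. These
    intervals are stable under intersection, generate the Borel sets, and exhaust the line as []-n,
    n]]. *)
Lemma measure_cdf_unique :
  (forall x : R, m1 `]-oo, x]%classic < +oo) ->
  (forall x : R, m1 `]-oo, x]%classic = m2 `]-oo, x]%classic) ->
  forall A, measurable A -> m1 A = m2 A.
Proof.
move=> m1y m12.
have m2y x : m2 `]-oo, x]%classic < +oo by rewrite -m12.
have m12oc a b : m1 `]a, b]%classic = m2 `]a, b]%classic.
  have [ab|ba] := leP a b; last first.
    by rewrite set_itv_ge ?measure0// bnd_simp -leNgt ltW.
  have -> : `]a, b]%classic = `]-oo, b] `\` `]-oo, a].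
    by rewrite -[RHS]setCK setCD setCitvl setUC -[LHS]setCK setCitv.
  have sub : `]-oo, a]%classic `<=` `]-oo, b]%classic by exact: subset_itvl.
  rewrite !measureD ?setIidr//.
  - by congr (_ - _); exact: m12.
  - exact: m2y.
  - exact: m1y.
apply: (@measure_unique _ _ (measurableTypeR R) (@ocitv R)
  (fun n => `](- n%:R)%R, n%:R]%classic) _ _ _ _ m1 m2) => //.
- exact: ocitvI.
- by move=> n; exact: is_ocitv.
- exact: bigcup_itvT.
- by move=> _ [[a b] _ <-]; exact: m12oc.
- move=> n; apply: le_lt_trans (m1y n%:R); apply: le_measure; rewrite ?inE//.
  exact: subset_itvr.
Qed.

End measure_cdf.

(** * Independence, and integration with one variable frozen *)

Section freeze.
Context {d d' : measure_display} {T : measurableType d}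
  {U : measurableType d'} {R : realType} {I : finType}.
Variables (P : probability T R) (X : I -> {mfun T >-> U}) (k : I).
Local Open Scope ereal_scope.

(** A pi-system that generates the events depending only on the [X j] with [j != k]. *)
Definition cylinders : set (set T) :=
  [set B | exists2 A : I -> set U, (forall j, measurable (A j)) &
    B = \bigcap_(j in [set j | j != k]) (X j @^-1` A j)].

Let Xm i (A : set U) : measurable A -> measurable (X i @^-1` A).
Proof. by move=> mA; rewrite -[X in measurable X]setTI; exact: measurable_funP. Qed.

Lemma cylinders_measurable : cylinders `<=` measurable.
Proof.
move=> _ [A mA ->]; apply: fin_bigcap_measurable => [|j _]; last exact: Xm.
exact: finite_finset.
Qed.

Lemma cylinders_setI : setI_closed cylinders.
Proof.
move=> _ _ [A mA ->] [B mB ->]; exists (fun j => A j `&` B j).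
  by move=> j; exact: measurableI.
by rewrite bigcapI.
Qed.

Lemma cylinders_setT : cylinders setT.
Proof. by exists (fun=> setT) => //; apply/seteqP; split. Qed.

Lemma cylinders_preimage i (A : set U) : i != k -> measurable A ->
  cylinders (X i @^-1` A).
Proof.
move=> ik mA; exists (fun j => if j == i then A else setT).
  by move=> j; case: ifP.
apply/seteqP; split => [w wA j _ /=|w /(_ i ik) /=]; last by rewrite eqxx.
by case: eqP => [->|].
Qed.

(* The space [T] with the coarser sigma-algebra generated by the [X j],
   [j != k]: [w |-> (X k w, w)] into [U * frozenType] then has a product law,
   so that Tonelli allows to integrate over [X k] with [w] kept fixed. *)
Definition frozenType := g_sigma_algebraType cylinders.

Definition to_frozen : T -> frozenType := id.

Lemma measurable_frozen : measurable_fun setT to_frozen.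
Proof.
move=> _ B mB; rewrite setTI.
suff: <<s cylinders >> `<=` measurable by exact.
by apply: smallest_sub; [exact: sigma_algebra_measurable|exact: cylinders_measurable].
Qed.

Lemma measurable_frozen_coordinate i : i != k ->
  measurable_fun setT (X i : frozenType -> U).
Proof.
move=> ik _ A mA; rewrite setTI; apply: sub_sigma_algebra.
exact: cylinders_preimage.
Qed.

HB.instance Definition _ := isMeasurableFun.Build _ _ _ _ to_frozen
  measurable_frozen.

Hypothesis XP : forall (J : {set I}) (A : I -> set U),
    (forall j, measurable (A j)) ->
    P (\bigcap_(j in [set j | j \in J]) (X j @^-1` A j)) =
    \prod_(j in J) P (X j @^-1` A j).

(** The product formula [XP] is used twice, over all indices and over all indices but [k]; the
    quotient is the factor of [k]. *)
Let indep_cylinder (A : set U) B : measurable A -> cylinders B ->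
  P (X k @^-1` A `&` B) = P (X k @^-1` A) * P B.
Proof.
move=> mA [C mC ->]; pose C' j := if j == k then A else C j.
have mC' j : measurable (C' j) by rewrite /C'; case: ifP.
have -> : X k @^-1` A `&` \bigcap_(j in [set j | j != k]) (X j @^-1` C j) =
    \bigcap_(j in [set j | j \in [set: I]%SET]) (X j @^-1` C' j).
  apply/seteqP; split => [w [wA wC] j _|w wC].
    by rewrite /C' /=; case: eqP => [->//|/eqP jk]; exact: wC.
  split; first by have := wC k (finset.in_setT _); rewrite /C' eqxx.
  by move=> j /= jk; have := wC j (finset.in_setT _); rewrite /C' (negbTE jk).
have -> : \bigcap_(j in [set j | j != k]) (X j @^-1` C j) =
    \bigcap_(j in [set j | j \in [set~ k]%SET]) (X j @^-1` C' j).
  apply/seteqP; split => w wC j /=.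
    by rewrite !inE => jk; rewrite /C' (negbTE jk); exact: wC.
  by move=> jk; have := wC j; rewrite /C' /= !inE (negbTE jk); exact.
rewrite !XP// (bigD1 k)//= {1}/C' eqxx; congr (_ * _).
by apply: eq_bigl => j; rewrite !inE.
Qed.

(** For fixed [A] both sides are finite measures in [B], namely a restriction of [P] and a multiple
    of [P]. They agree on the pi-system of cylinders, hence on the sigma-algebra it generates. *)
Let indep (A : set U) (B : set frozenType) : measurable A -> measurable B ->
  P (X k @^-1` A `&` B) = P (X k @^-1` A) * P B.
Proof.
move=> mA mB; pose c : {nonneg R} := NngNum (fine_ge0 (measure_ge0 P (X k @^-1` A))).
have cE : c%:num%:E = P (X k @^-1` A).
  by rewrite fineK// fin_num_measure//; exact: Xm.
rewrite -cE setIC -[LHS]/(mrestr P (Xm k A mA) B) -[RHS]/(mscale c P B).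
apply: (g_sigma_algebra_measure_unique cylinders cylinders_measurable
  (fun=> setT) (fun=> cylinders_setT) _ (mrestr P (Xm k A mA)) (mscale c P)
  cylinders_setI) => //.
- by apply/seteqP; split => // w _; exists 0%N.
- move=> C cC; rewrite /= /mrestr /mscale cE setIC; exact: indep_cylinder.
- move=> _; rewrite /= /mrestr setTI ltey_eq fin_num_measure//; exact: Xm.
Qed.

Let XkT w : U * frozenType := (X k w, w).

Let measurable_XkT : measurable_fun setT XkT.
Proof. exact: (@measurable_fun_pair _ _ _ _ _ _ (X k) to_frozen). Qed.

HB.instance Definition _ := isMeasurableFun.Build _ _ _ _ XkT measurable_XkT.

Variable h : U * frozenType -> \bar R.
Hypotheses (mh : measurable_fun setT h) (h0 : forall x, 0 <= h x).

Lemma measurable_frozen_section u : measurable_fun [set: T] (fun w => h (u, w)).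
Proof. exact: measurableT_comp (measurable_fun_pair2 u mh) measurable_frozen. Qed.

Let integral_frozen u : \int[distribution P to_frozen]_w h (u, w) =
  \int[P]_w h (u, w).
Proof.
rewrite ge0_integral_distribution//; exact: measurable_fun_pair2.
Qed.

Lemma measurable_integral_freeze :
  measurable_fun setT (fun u => \int[P]_w h (u, w)).
Proof.
apply: (eq_measurable_fun
    (fubini_F (distribution P to_frozen) h)) => [u _|].
  exact: integral_frozen.
exact: measurable_fun_fubini_tonelli_F.
Qed.

(** The law of [XkT] is a product law because [indep] gives its values on rectangles; Tonelli then
    yields the iterated integral. *)
Lemma integral_freeze : \int[P]_w h (X k w, w) =
  \int[distribution P (X k)]_u \int[P]_w h (u, w).
Proof.
transitivity (\int[distribution P XkT]_z h z).
  by rewrite ge0_integral_distribution.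
rewrite (eq_measure_integral (distribution P (X k) \x
    distribution P to_frozen)); last first.
  by move=> A mA _; exact/esym/product_measure_unique.
rewrite fubini_tonelli1//.
by apply: eq_integral => u _; exact: integral_frozen.
Qed.

End freeze.

(** * The law of a single reward *)

Section group.
Context {d : measure_display} {T : measurableType d} {R : realType} {G : nat}.
Variable P : probability T R.
Variable r : 'I_G -> {mfun T >-> measurableTypeR R}.
Variables (F f : R -> R) (sigma : R).
Hypotheses (r01 : forall i w, 0 <= (r i w : R) <= 1)
  (rP : mutually_independent P (fun i => r i : T -> R))
  (f0 : forall x, 0 <= f x) (mf : measurable_fun setT f)
  (FE : forall x, (F x)%:E =
     (\int[@lebesgue_measure R]_(y in `]-oo, x]) (f y)%:E)%E)
  (rF : forall i x, P (r i @^-1` `]-oo, x]%classic) = (F x)%:E)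
  (sigma0 : 0 <= sigma).
Local Open Scope ereal_scope.

Local Notation mu := (@lebesgue_measure R).
Local Notation window u := `[u, uplus sigma u]%classic.
Local Notation q := (qfun F sigma).

Let law_cdf i x : distribution P (r i) `]-oo, x]%classic = (F x)%:E.
Proof. exact: rF. Qed.

(** By [rF] and [FE] the law and the measure with density [f] have the same distribution
    function. *)
Lemma law_density i A : measurable A ->
  distribution P (r i) A = \int[mu]_(x in A) (f x)%:E.
Proof.
move=> mA; rewrite -[RHS]/(density _ _ _ mu _ f0 mf A).
apply: measure_cdf_unique => // x.
- by rewrite [ltLHS](law_cdf i x) ltry.
- exact: etrans (law_cdf i x) (FE x).
Qed.

Lemma law_point i x : distribution P (r i) [set x] = 0.
Proof. by rewrite law_density ?integral_set1. Qed.

(** All rewards lie in [[0, 1]], so the law can be restricted to this interval before the density is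
    inserted. *)
Lemma ge0_integral_law i (g : R -> \bar R) : measurable_fun setT g ->
  (forall x, 0 <= g x) ->
  \int[distribution P (r i)]_x g x = \int[mu]_(x in `[0%R, 1%R]) (g x * (f x)%:E).
Proof.
move=> mg g0; transitivity (\int[distribution P (r i)]_(x in `[0%R, 1%R]) g x).
  rewrite ge0_integral_distribution//.
  rewrite ge0_integral_pushforward//; last exact: measurable_funTS.
  by congr integral; apply/esym/seteqP; split => // w _ /=; rewrite in_itv/= r01.
apply: ge0_integral_density => //.
- exact: law_density.
- exact: measurable_funTS.
Qed.

(** * Windows above [u] and the events [box k] *)

Lemma uplus_ge (u : R) : (u <= 1)%R -> (u <= uplus sigma u)%R.
Proof. by move=> u1; rewrite /uplus le_min u1/= lerDl. Qed.

Lemma law_window i (u : R) : (u <= 1)%R ->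
  P (r i @^-1` window u) = (q u)%:E.
Proof.
move=> u1; have uu := uplus_ge _ u1.
transitivity (\int[mu]_(x in `[u, uplus sigma u]) (f x)%:E).
  by rewrite -(law_density i).
(* The left end point is Lebesgue-null; without it the window is a difference of two half-lines,
   whose probabilities are values of [F]. *)
rewrite -(@integral_itv_obnd_cbnd _ u (BRight (uplus sigma u))); last first.
  exact/measurable_EFinP/measurable_funTS.
rewrite -(law_density i)//.
have -> : `]u, uplus sigma u]%classic = `]-oo, uplus sigma u] `\` `]-oo, u].
  by rewrite -[RHS]setCK setCD setCitvl setUC -[LHS]setCK setCitv.
have sub : `]-oo, u]%classic `<=` `]-oo, uplus sigma u]%classic.
  exact: subset_itvl.
rewrite measureD ?setIidr//.
  by rewrite /qfun EFinB; congr (_ - _); exact: law_cdf.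
by rewrite ltey_eq fin_num_measure.
Qed.

Definition box k : set (measurableTypeR R * frozenType r k) :=
  [set z | forall j, j != k -> window z.1 (r j z.2)].

Lemma measurable_box k : measurable (box k).
Proof.
have -> : box k = \bigcap_(j in [set j | j != k])
    ([set z | (z.1 <= (r j z.2 : R))%R] `&`
     [set z | ((r j z.2 : R) <= uplus sigma z.1)%R]).
  apply/seteqP; split => z zb j jk; have := zb j jk; rewrite /= in_itv/=.
    by move/andP.
  by case=> -> ->.
apply: fin_bigcap_measurable; first exact: finite_finset.
move=> j jk.
have mj : measurable_fun setT (fun z : measurableTypeR R * frozenType r k => r j z.2 : R).
  apply: (measurableT_comp (measurable_frozen_coordinate r k j jk)).
  exact: measurable_snd.
have mfst : measurable_fun setT (fun z : measurableTypeR R * frozenType r k => z.1 : R).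
  exact: measurable_fst.
apply: measurableI; rewrite -[X in measurable X]setTI; apply: measurable_fun_le => //.
apply: measurable_minr => //; exact: measurable_funD.
Qed.

Lemma prob_windows (J : {set 'I_G}) (u : R) : (u <= 1)%R ->
  P (\bigcap_(j in [set j | j \in J]) (r j @^-1` window u)) = (q u ^+ #|J|)%:E.
Proof.
move=> u1; rewrite (rP J (fun=> window u))//.
under eq_bigr do rewrite law_window//.
by rewrite prodEFin prodr_const.
Qed.

(* [rP] restated for the Borel structure [measurableTypeR R] of the [r i]. *)
Let rP' := rP : forall (J : {set 'I_G}) (A : 'I_G -> set (measurableTypeR R)),
  (forall j, measurable (A j)) ->
  P (\bigcap_(j in [set j | j \in J]) (r j @^-1` A j)) =
  \prod_(j in J) P (r j @^-1` A j).

Let measurable_r i (A : set R) : measurable A -> measurable (r i @^-1` A).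
Proof. by move=> mA; rewrite -[X in measurable X]setTI; exact: measurable_funP. Qed.

Let measurable_windows (J : {set 'I_G}) (u : R) :
  measurable (\bigcap_(j in [set j | j \in J]) (r j @^-1` window u)).
Proof.
by apply: fin_bigcap_measurable => [|j _]; [exact: finite_finset|exact: measurable_r].
Qed.

(** For fixed [u] the section of the box is an intersection of [G.-1] independent window events. *)
Lemma integral_box k (u : R) : (u <= 1)%R ->
  \int[P]_w (\1_(box k) (u, w))%:E = (q u ^+ G.-1)%:E.
Proof.
move=> u1; transitivity (\int[P]_w
    (\1_(\bigcap_(j in [set j | j \in [set~ k]%SET]) (r j @^-1` window u)) w)%:E).
  apply: eq_integral => w _; rewrite !indicE; congr (nat_of_bool _)%:R%:E.
  apply/idP/idP => /set_mem wb; apply/mem_set => j /=.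
    by rewrite !inE => jk; exact: wb.
  by move=> jk; apply: wb; rewrite /= !inE.
by rewrite integral_indic//= setIT prob_windows// cardsC1 card_ord.
Qed.

Lemma measurable_xf (D : set R) : measurable_fun D (fun x => (x * f x)%:E).
Proof.
apply/measurable_EFinP; apply: measurable_funM => //.
exact: measurable_funTS.
Qed.

(** On the window [0 <= x <= 1], hence [0 <= x * f x <= f x]. The bound by [q u] makes the numerator
    of [mcond] finite, and zero wherever [q u] is zero. *)
Lemma window_moment (i : 'I_G) (u : R) : (0 <= u <= 1)%R ->
  exists2 M : R, \int[mu]_(x in window u) (x * f x)%:E = M%:E & (0 <= M <= q u)%R.
Proof.
move=> /andP[u0 u1].
have win x : window u x -> (0 <= x <= 1)%R.
  rewrite /= in_itv/= /uplus le_min => /and3P[ux -> _].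
  by rewrite (le_trans u0 ux).
have int0 : 0 <= \int[mu]_(x in window u) (x * f x)%:E.
  apply: integral_ge0 => x /win/andP[x0 _].
  by rewrite lee_fin mulr_ge0.
have intq : \int[mu]_(x in window u) (x * f x)%:E <= (q u)%:E.
  rewrite -(law_window i)// -[leRHS]/(distribution P (r i) _) law_density//.
  apply: ge0_le_integral => //.
  - by move=> x /win/andP[x0 _]; rewrite lee_fin mulr_ge0.
  - exact: measurable_xf.
  - exact/measurable_EFinP/measurable_funTS.
  - by move=> x /win/andP[x0 x1]; rewrite lee_fin ler_piMl.
exists (fine (\int[mu]_(x in window u) (x * f x)%:E)).
  rewrite fineK// ge0_fin_numE//; exact: le_lt_trans intq (ltry _).
rewrite fine_ge0//= -lee_fin fineK// ge0_fin_numE//.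
exact: le_lt_trans intq (ltry _).
Qed.

Lemma integral_coordinate_box i k (u : R) : i != k -> (0 <= u <= 1)%R ->
  \int[P]_w ((r i w : R) * \1_(box k) (u, w))%:E =
  \int[mu]_(x in window u) (x * f x)%:E * (q u ^+ (G - 2))%:E.
Proof.
move=> ik u01; have /andP[u0 u1] := u01.
pose B := \bigcap_(j in [set j | j \in ~: [set i; k]%SET]) (r j @^-1` window u).
(* The absolute value makes [h] nonnegative everywhere and changes nothing on rewards. *)
pose h (z : measurableTypeR R * frozenType r i) :=
  (`|z.1 : R| * \1_(window u) (z.1 : R) * \1_(B : set T) (z.2 : T))%:E.
(* Measurability is required in the coarser sigma-algebra, so [B] is written as a cylinder with the
   full space at index [k]. *)
have mB : measurable (B : set (frozenType r i)).
  apply: sub_sigma_algebra; exists (fun j => if j == k then setT else window u).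
    by move=> j; case: ifP.
  apply/seteqP; split => w wB j /=.
    move=> ji; have [//|jk] := eqVneq j k.
    by apply: wB; rewrite /= !inE negb_or ji.
  rewrite !inE negb_or => /andP[ji jk]; have := wB j ji.
  by rewrite /= (negbTE jk).
have mw : measurable (window u) by [].
have mh : measurable_fun setT h.
  apply/measurable_EFinP/measurable_funM; first apply/measurable_funM.
  - exact: (measurableT_comp (@normr_measurable _ setT) measurable_fst).
  - exact: (measurableT_comp (measurable_indic mw) measurable_fst).
  - exact: (measurableT_comp (measurable_indic mB) measurable_snd).
have h0 z : 0 <= h z by rewrite lee_fin !mulr_ge0.
transitivity (\int[P]_w h (r i w, w)).
  apply: eq_integral => w _; congr EFin; rewrite /= -mulrA.
  have /andP[ri0 _] := r01 i w; rewrite ger0_norm//; congr (_ * _)%R.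
  rewrite !indicE -natrM mulnb; congr (nat_of_bool _)%:R.
  apply/idP/andP => [/set_mem wb|[/set_mem wi /set_mem wB]].
    split; apply/mem_set; first exact: wb.
    by move=> j /=; rewrite !inE negb_or => /andP[_ jk]; exact: wb.
  apply/mem_set => j /= jk; have [->//|ji] := eqVneq j i.
  by apply: wB; rewrite /= !inE negb_or ji.
rewrite (integral_freeze P r i rP' h mh h0).
have inner (x : R) : \int[P]_w h (x, w) =
    (`|x| * \1_(window u) x)%:E * (q u ^+ (G - 2))%:E.
  transitivity (\int[P]_w ((`|x| * \1_(window u) x)%:E * (\1_B w)%:E)).
    by apply: eq_integral => w _; rewrite -EFinM.
  rewrite ge0_integralZl_EFin//; last first.
    exact/measurable_EFinP/measurable_indic/measurable_windows.
  rewrite integral_indic//=; last exact: measurable_windows.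
  by rewrite setIT prob_windows// cardsCs finset.setCK cards2 ik card_ord.
under eq_integral do rewrite inner.
have mg : measurable_fun setT
    (fun x : R => (`|x| * \1_(window u) x)%:E * (q u ^+ (G - 2))%:E).
  apply: emeasurable_funM => //; apply/measurable_EFinP/measurable_funM.
    exact: normr_measurable.
  exact: measurable_indic.
have q0 : (0 <= q u)%R.
  by have [M _ /andP[M0 Mq]] := window_moment i u u01; exact: le_trans M0 Mq.
rewrite ge0_integral_law//; last first.
  by move=> x; rewrite mule_ge0// lee_fin ?mulr_ge0 ?exprn_ge0.
rewrite muleC -ge0_integralZl_EFin ?exprn_ge0//; last 2 first.
- move=> x; rewrite /= in_itv/= => /andP[ux _].
  by rewrite lee_fin mulr_ge0// (le_trans u0 ux).
- exact: measurable_xf.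
(* The window lies in [[0, 1]], which reconciles the two domains of integration. *)
have winE : window u = `[0%R, 1%R] `&` window u.
  apply/esym/setIidr => x; rewrite /= !in_itv/= => /andP[ux].
  by rewrite /uplus le_min => /andP[-> _]; rewrite (le_trans u0 ux).
rewrite [in RHS]winE [RHS]integral_mkcondr; apply: eq_integral => x.
rewrite inE/= in_itv/= => /andP[x0 x1].
rewrite patchE -!EFinM; have [xu|xu] := boolP (x \in window u).
  rewrite indicE xu ger0_norm// mulr1.
  by congr EFin; ring.
by rewrite indicE (negbTE xu) mulr0 !mul0r.
Qed.

(** * Absence of ties between rewards *)

Lemma negligible_coincidence i k : i != k ->
  P.-negligible [set w | r i w = r k w].
Proof.
move=> ik; pose D : set (measurableTypeR R * frozenType r k) :=
  [set z | (r i z.2 : R) = z.1].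
have mi : measurable_fun setT
    (fun z : measurableTypeR R * frozenType r k => r i z.2 : R).
  apply: (measurableT_comp (measurable_frozen_coordinate r k i ik)).
  exact: measurable_snd.
have mfst : measurable_fun setT
    (fun z : measurableTypeR R * frozenType r k => z.1 : R).
  exact: measurable_fst.
have mD : measurable D.
  have -> : D = [set z | ((r i z.2 : R) <= z.1)%R] `&`
      [set z | (z.1 <= (r i z.2 : R))%R].
    apply/seteqP; split => [z /= ->//|z [/= h1 h2]].
    by apply/eqP; rewrite eq_le h1.
  by apply: measurableI; rewrite -[X in measurable X]setTI; exact: measurable_fun_le.
have mh : measurable_fun setT (fun z => (\1_D z)%:E : \bar R).
  exact/measurable_EFinP/measurable_indic.
have h0 z : 0 <= (\1_D z)%:E :> \bar R by rewrite lee_fin.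
have freeze := integral_freeze P r k rP' _ mh h0.
have mE : measurable [set w | r i w = r k w].
  have -> : [set w | r i w = r k w] = (fun w => (r k w, to_frozen r k w)) @^-1` D by [].
  rewrite -[X in measurable X]setTI.
  apply: (measurable_fun_pair (measurable_funP (r k)) (measurable_frozen r k)) => //.
apply/negligibleP => //.
transitivity (\int[P]_w (\1_[set w | r i w = r k w] w)%:E).
  by rewrite integral_indic//= setIT.
rewrite [LHS](_ : _ = \int[P]_w (\1_D (r k w, w))%:E)// freeze.
(* With [r k] frozen at [u] the inner integral is the probability of [r i = u], which is zero
   because the law has no atoms. *)
rewrite (eq_integral (cst 0)) ?integral0// => u _.
transitivity (\int[P]_w (\1_(r i @^-1` [set u]) w)%:E) => //.
rewrite integral_indic//=.
by rewrite setIT; exact: law_point.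
Qed.

(** * Integrals over the event that [r k] is least and the others lie in its window *)

Lemma prob_min_box k :
  \int[P]_w (\1_(box k) (r k w, w))%:E =
  \int[mu]_(u in `[0%R, 1%R]) (f u * q u ^+ G.-1)%:E.
Proof.
pose h z : \bar R := (\1_(box k) z)%:E.
have mh : measurable_fun setT h.
  by apply/measurable_EFinP; exact: (measurable_indic (measurable_box k)).
have h0 z : 0 <= h z by rewrite lee_fin.
rewrite (integral_freeze P r k rP' h mh h0) ge0_integral_law//; last 2 first.
- exact: (measurable_integral_freeze P r k h mh h0).
- by move=> u; exact: integral_ge0.
apply: eq_integral => u; rewrite inE/= in_itv/= => /andP[_ u1].
by rewrite integral_box// -EFinM mulrC.
Qed.

(** With [r k] frozen at [u], the term of [k] gives [u * q u ^+ G.-1] and each other term gives the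
    window moment times [q u ^+ (G - 2)]. The moment is [mcond] times [q u], which restores the
    exponent [G.-1]. *)
Lemma integral_sum_min_box k : (2 <= G)%N ->
  \int[P]_w ((\sum_i (r i w : R)) * \1_(box k) (r k w, w))%:E =
  \int[mu]_(u in `[0%R, 1%R])
    ((u + G.-1%:R * mcond F f sigma u) * f u * q u ^+ G.-1)%:E.
Proof.
move=> G2.
(* The absolute value only serves to make [c] nonnegative for all [z.1]. *)
pose c i (z : measurableTypeR R * frozenType r k) : R :=
  (if i == k then `|z.1 : R| else r i z.2)%R.
have mc i : measurable_fun setT (c i).
  rewrite /c; case: eqVneq => [_|ik].
    exact: (measurableT_comp (@normr_measurable _ setT) measurable_fst).
  apply: (measurableT_comp (measurable_frozen_coordinate r k i ik)).
  exact: measurable_snd.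
have c0 i z : (0 <= c i z)%R.
  by rewrite /c; case: ifP => // _; have /andP[] := r01 i z.2.
pose g i z := (c i z * \1_(box k) z)%:E : \bar R.
have mg i : measurable_fun setT (g i).
  by apply/measurable_EFinP/measurable_funM => //; exact: (measurable_indic (measurable_box k)).
have g0 i z : 0 <= g i z by rewrite lee_fin mulr_ge0.
pose h z := \sum_(i < G) g i z.
have mh : measurable_fun setT h by exact: emeasurable_sum.
have h0 z : 0 <= h z by exact: sume_ge0.
transitivity (\int[P]_w h (r k w, w)).
  apply: eq_integral => w _; rewrite /h /g sumEFin -mulr_suml; congr (_ * _)%:E.
  apply: eq_bigr => i _; rewrite /c /=; case: eqVneq => [->|//].
  by have /andP[rk0 _] := r01 k w; rewrite ger0_norm.
rewrite (integral_freeze P r k rP' h mh h0) ge0_integral_law//; last 2 first.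
- exact: (measurable_integral_freeze P r k h mh h0).
- by move=> u; exact: integral_ge0.
apply: eq_integral => u; rewrite inE/= in_itv/= => u01; have /andP[u0 u1] := u01.
have mgu i : measurable_fun [set: T] (fun w => g i (u, w)).
  exact: (measurable_frozen_section r k (g i) (mg i) (u : measurableTypeR R)).
rewrite /h ge0_integral_sum//.
have [M ME /andP[M0 Mq]] := window_moment k u u01.
rewrite (bigD1 k)//=.
have -> : \int[P]_w g k (u, w) = (u * q u ^+ G.-1)%:E.
  transitivity (\int[P]_w (u%:E * (\1_(box k) (u, w))%:E)).
    by apply: eq_integral => w _; rewrite /g /c eqxx ger0_norm.
  rewrite ge0_integralZl_EFin ?integral_box//.
  apply: (measurable_frozen_section r k (EFin \o \1_(box k)) _ (u : measurableTypeR R)).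
  by apply/measurable_EFinP; exact: (measurable_indic (measurable_box k)).
have gE i : i != k -> \int[P]_w g i (u, w) = (M * q u ^+ (G - 2))%:E.
  move=> ik; transitivity (\int[P]_w ((r i w : R) * \1_(box k) (u, w))%:E).
    by apply: eq_integral => w _; rewrite /g /c (negbTE ik).
  by rewrite integral_coordinate_box// ME.
rewrite (eq_bigr (fun=> (M * q u ^+ (G - 2))%:E))//.
rewrite sumEFin sumr_const cardC1 card_ord -EFinD -EFinM.
rewrite /mcond ME/=; congr EFin.
have -> : G.-1 = (G - 2).+1 by case: (G) G2 => [|[|n]]//= _; rewrite subn2.
(* If [q u = 0] the quotient in [mcond] is only a default value; both sides vanish, since [M <= q u]
   forces [M = 0]. This is essential for [G = 2], where the power [G - 2] is 1. *)
rewrite exprS -mulr_natl; have [q0|q0] := eqVneq (q u) 0%R.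
  have -> : M = 0%R by apply/eqP; rewrite eq_le M0 -q0 Mq.
  by rewrite q0; ring.
by field.
Qed.

(** * Decomposition of the complement of the update event *)

Lemma setC_Supd : (0 < G)%N ->
  ~` Supd (fun i => r i : T -> R) sigma = \bigcup_k [set w | box k (r k w, w)].
Proof.
move=> G0; apply/seteqP; split => [w wS|w [k _ wk] [i [j [ij]]]].
  (* The box is that of a least reward; the cap at 1 in [uplus] is harmless because rewards are at
     most 1. *)
  pose m := [arg min_(i < Ordinal G0) (r i w : R)]%O; exists m => // j jm /=.
  have mj : ((r m w : R) <= r j w)%R.
    by rewrite /m; case: arg_minP => //= i _; exact.
  have /andP[_ rj1] := r01 j w.
  rewrite in_itv/= mj /uplus le_min rj1/= addrC -lerBlDr.
  rewrite (le_trans (ler_norm _))// leNgt; apply/negP => sjm; apply: wS.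
  by exists j, m.
(* Conversely all rewards, [r k] included, lie in one interval of length [sigma]. *)
have win l : ((r k w : R) <= r l w <= r k w + sigma)%R.
  have [->|lk] := eqVneq l k; first by rewrite lexx lerDl.
  have := wk l lk; rewrite /= in_itv/= /uplus le_min => /andP[-> /andP[_ ->]].
  by [].
apply/negP; rewrite -leNgt ler_norml.
by have := win i; have := win j; lra.
Qed.

Let measurable_min_box k : measurable [set w | box k (r k w, w)].
Proof.
rewrite -[X in measurable X]setTI.
by apply: (measurable_fun_pair (measurable_funP (r k)) (measurable_frozen r k)) => //;
  exact: measurable_box.
Qed.

Lemma measurable_Supd : (0 < G)%N ->
  measurable (Supd (fun i => r i : T -> R) sigma).
Proof.
move=> G0; rewrite -[X in measurable X]setCK; apply: measurableC.
by rewrite setC_Supd//; apply: fin_bigcup_measurable.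
Qed.

(** Off the finitely many tie events two boxes cannot both hold, since each would bound the reward
    of one index by that of the other. *)
Lemma ae_indic_setC_Supd : (0 < G)%N ->
  {ae P, forall w, \1_(~` Supd (fun i => r i : T -> R) sigma) w =
    (\sum_k \1_(box k) (r k w, w))%R :> R}.
Proof.
move=> G0.
have : P.-negligible (\big[setU/set0]_(z : 'I_G * 'I_G | z.1 != z.2)
    [set w | r z.1 w = r z.2 w]).
  apply: (big_ind (fun A => P.-negligible A)).
  - exact: negligible_set0.
  - by move=> A B; exact: negligibleU.
  - by move=> [i j] /= ij; exact: negligible_coincidence.
apply: negligibleS => w /= wE; apply: contrapT => wN; apply: wE.
have inj i j : r i w = r j w -> i = j.
  by move=> rij; apply/eqP/negPn/negP => ij; apply: wN;
    rewrite (bigD1 (i, j))//=; left.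
rewrite indicE; case: (boolP (w \in _)).
  rewrite inE setC_Supd// => -[k _ wk]; rewrite (bigD1 k)//= big1 ?addr0.
    by rewrite indicE mem_set.
  move=> l lk; rewrite indicE memNset// => wl.
  have := wk l lk; have := wl k; rewrite eq_sym lk => /(_ isT).
  rewrite /= !in_itv/= => /andP[lek _] /andP[kle _].
  by move/eqP : lk; apply; apply: inj; apply/eqP; rewrite eq_le lek.
rewrite notin_setE => wS; rewrite big1// => k _; rewrite indicE memNset// => wk.
by apply: wS; rewrite setC_Supd//; exists k.
Qed.

(** Used with [phi = 1] for the probability and with [phi = phat] for the expectation. *)
Lemma integral_setC_Supd (phi : T -> R) : (0 < G)%N ->
  measurable_fun setT phi -> (forall w, 0 <= phi w)%R ->
  \int[P]_(w in ~` Supd (fun i => r i : T -> R) sigma) (phi w)%:E =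
  \sum_k \int[P]_w (phi w * \1_(box k) (r k w, w))%:E.
Proof.
move=> G0 mphi phi0; have mS := measurable_Supd G0.
have mk k : measurable_fun setT (fun w => (phi w * \1_(box k) (r k w, w))%:E).
  apply/measurable_EFinP/measurable_funM => //.
  exact: (measurable_indic (measurable_min_box k)).
rewrite -ge0_integral_sum//; last first.
  by move=> k w _; rewrite lee_fin mulr_ge0.
rewrite [LHS]integral_mkcond epatch_indic.
apply: (ae_eq_integral (fun w => \sum_k (phi w * \1_(box k) (r k w, w))%:E)) => //.
- apply: emeasurable_funM; first exact/measurable_EFinP.
  by apply/measurable_EFinP; apply: measurable_indic; exact: measurableC.
- exact: emeasurable_sum.
- apply: filterS (ae_indic_setC_Supd G0) => w wE _.
  by rewrite sumEFin -mulr_sumr -wE EFinM.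
Qed.

(** * The two integral formulas *)

Lemma prob_setC_Supd : (0 < G)%N ->
  P (~` Supd (fun i => r i : T -> R) sigma) =
  G%:R%:E * \int[mu]_(u in `[0%R, 1%R]) (f u * q u ^+ G.-1)%:E.
Proof.
move=> G0; have mS := measurable_Supd G0.
transitivity (\int[P]_(w in ~` Supd (fun i => r i : T -> R) sigma) 1%:E).
  by rewrite integral_cst ?mul1e//; exact: measurableC.
rewrite (integral_setC_Supd (fun=> 1%R))//.
under eq_bigr.
  move=> k _; under eq_integral do rewrite mul1r.
  rewrite prob_min_box; over.
by rewrite sumr_const card_ord mule_natl.
Qed.

Lemma measurable_phat : measurable_fun setT (phat (fun i => r i : T -> R)).
Proof.
apply: measurable_funM => //; apply: measurable_sum => i.
exact: (measurable_funP (r i)).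
Qed.

Lemma phat_itv w : (0 < G)%N -> (0 <= phat (fun i => r i : T -> R) w <= 1)%R.
Proof.
move=> G0; rewrite /phat mulr_ge0 ?invr_ge0//=; last first.
  by apply: sumr_ge0 => i _; have /andP[] := r01 i w.
rewrite mulrC ler_pdivrMr ?ltr0n// mul1r.
rewrite -[leRHS](_ : \sum_(i < G) 1 = _)%R; last by rewrite sumr_const card_ord.
by apply: ler_sum => i _; have /andP[] := r01 i w.
Qed.

(** The [G] boxes contribute equally, and their number cancels the factor [1/G] of [phat]. *)
Lemma integral_phat_setC_Supd : (2 <= G)%N ->
  \int[P]_(w in ~` Supd (fun i => r i : T -> R) sigma)
    (phat (fun i => r i : T -> R) w)%:E =
  \int[mu]_(u in `[0%R, 1%R])
    ((u + G.-1%:R * mcond F f sigma u) * f u * q u ^+ G.-1)%:E.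
Proof.
move=> G2; have G0 : (0 < G)%N by exact: ltnW.
set J := RHS; rewrite integral_setC_Supd//; last 2 first.
- exact: measurable_phat.
- by move=> w; have /andP[] := phat_itv w G0.
rewrite (eq_bigr (fun=> G%:R^-1%:E * J)) => [|k _]; last first.
  rewrite /J -(integral_sum_min_box k)// -ge0_integralZl_EFin ?invr_ge0//.
  - by apply: eq_integral => w _; rewrite /phat -mulrA EFinM.
  - move=> w _; rewrite lee_fin mulr_ge0// sumr_ge0// => i _.
    by have /andP[] := r01 i w.
  - apply/measurable_EFinP/measurable_funM.
      by apply: measurable_sum => i; exact: (measurable_funP (r i)).
    exact: (measurable_indic (measurable_min_box k)).
transitivity (G%:R%:E * (G%:R^-1%:E * J)).
  by rewrite sumr_const card_ord mule_natl.
rewrite muleA -EFinM mulfV ?mul1e//.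
by rewrite pnatr_eq0 -lt0n.
Qed.

End group.

(** * Assembly, and conditional expectations given the update event *)

Theorem theorem4 (d : measure_display) (T : measurableType d) (R : realType)
  (P : probability T R) (G : nat) (r : 'I_G -> T -> R)
  (F f : R -> R) (p sigma : R) :
  (2 <= G)%N ->
  (forall i, measurable_fun setT (r i)) ->
  (forall i w, 0 <= r i w <= 1) ->
  mutually_independent P r ->
  (forall x, 0 <= f x) ->
  measurable_fun setT f ->
  (forall x, (F x)%:E = (\int[@lebesgue_measure R]_(y in `]-oo, x]) (f y)%:E)%E) ->
  (forall i x, P (r i @^-1` `]-oo, x]) = (F x)%:E) ->
  (forall i, (\int[P]_w (r i w)%:E)%E = p%:E) ->
  0 <= sigma <= 1 ->
  let S := Supd r sigma in
  [/\ P (~` S) = ((G%:R)%:E *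
        \int[@lebesgue_measure R]_(u in `[0%R, 1%R])
           ((f u * qfun F sigma u ^+ G.-1)%R)%:E)%E,
      P S = (1 - P (~` S))%E,
      (\int[P]_(w in ~` S) (phat r w)%:E)%E =
        (\int[@lebesgue_measure R]_(u in `[0%R, 1%R])
           (((u + (G.-1)%:R * mcond F f sigma u) * f u * qfun F sigma u ^+ G.-1)%R)%:E)%E
    & (0 < P S)%E ->
      condE P S (phat r) =
        (p - fine (\int[P]_(w in ~` S) (phat r w)%:E)%E) / fine (P S) /\
      (forall i, condE P S (fun w => Ahat r i w - Aexp r p i w)
                 = p - condE P S (phat r))].
Proof.
move=> G2 mr r01 rP f0 mf FE rF rp /andP[sigma0 _] S.
have G0 : (0 < G)%N by exact: ltnW.
(* The rewards are bundled as measurable functions into the Borel structure [measurableTypeR R], the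
   form used in the preceding lemmas. *)
pose X i : {mfun T >-> measurableTypeR R} :=
  HB.pack (r i) (isMeasurableFun.Build _ _ T (measurableTypeR R) (r i) (mr i)).
have mS : measurable S by exact: (measurable_Supd X sigma r01 sigma0 G0).
have mphat : measurable_fun setT (phat r) by exact: (measurable_phat X).
have phat01 w : 0 <= phat r w <= 1 by exact: (phat_itv X r01 w G0).
have PSE : P S = (1 - P (~` S))%E.
  by rewrite -{1}[S]setCK probability_setC//; exact: measurableC.
split => //.
- exact: (prob_setC_Supd P X F f sigma r01 rP f0 mf FE rF sigma0 G0).
- exact: (integral_phat_setC_Supd P X F f sigma r01 rP f0 mf FE rF sigma0 G2).
move=> PS0.
have PSfin : P S \is a fin_num by exact: fin_num_measure.
have fPS0 : fine (P S) != 0 by rewrite gt_eqF// fine_gt0// PS0 ltey_eq PSfin.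
(* Boundedness of [phat] makes its integrals finite, so that [fine] commutes with the sums and
   differences below. *)
have iphat D : measurable D -> P.-integrable D (EFin \o phat r).
  move=> mD; apply: measurable_bounded_integrable => //.
  - by rewrite ltey_eq fin_num_measure.
  - exact: measurable_funTS.
  - exists 1; split; first exact: num_real.
    move=> x x1 w _ /=; have /andP[w0 w1] := phat01 w.
    by rewrite ger0_norm// (le_trans w1)// ltW.
have mSC : measurable (~` S) by exact: measurableC.
(* Linearity: [G] equal means [p] cancel the factor [1/G]. *)
have Ephat : (\int[P]_w (phat r w)%:E = p%:E)%E.
  rewrite /phat; under eq_integral do rewrite EFinM -sumEFin.
  rewrite ge0_integralZl_EFin ?invr_ge0//; last 2 first.
  - by move=> w _; apply: sume_ge0 => i _; rewrite lee_fin; have /andP[] := r01 i w.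
  - by apply: emeasurable_sum => i; exact/measurable_EFinP.
  rewrite ge0_integral_sum//; last 2 first.
  - by move=> i; exact/measurable_EFinP.
  - by move=> i w _; rewrite lee_fin; have /andP[] := r01 i w.
  under eq_bigr do rewrite rp.
  rewrite sumEFin sumr_const card_ord -EFinM -[p *+ G]mulr_natl mulKf//.
  by rewrite pnatr_eq0 -lt0n.
have splitS : (\int[P]_(w in S) (phat r w)%:E +
    \int[P]_(w in ~` S) (phat r w)%:E = p%:E)%E.
  rewrite -Ephat -[in RHS](setUv S) integral_setU//.
  - exact/measurable_EFinP/measurable_funTS.
  - by apply/disj_setPS => w [].
have finS := integrable_fin_num mS (iphat S mS).
have finSC := integrable_fin_num mSC (iphat _ mSC).
have condphat : condE P S (phat r) =
    (p - fine (\int[P]_(w in ~` S) (phat r w)%:E)%E) / fine (P S).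
  rewrite /condE; congr (_ / _); apply/eqP; rewrite -subr_eq opprK; apply/eqP.
  by rewrite -fineD// splitS.
split => // i; rewrite {1}/condE.
(* Pointwise the difference of advantages is [p - phat], whatever [i] is. *)
have -> : (\int[P]_(w in S) (Ahat r i w - Aexp r p i w)%:E =
    p%:E * P S - \int[P]_(w in S) (phat r w)%:E)%E.
  transitivity (\int[P]_(w in S) (cst p%:E w - (EFin \o phat r) w))%E.
    by apply: eq_integral => w _; rewrite /Ahat /Aexp /= -EFinB; congr EFin; ring.
  rewrite integralB ?integral_cst//; last exact: iphat.
  exact: finite_measure_integrable_cst.
rewrite fineB// ?fin_numM// fineM//= mulrBl mulfK//.
Qed.
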